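(* Let $G$ be a complete $k$-partite graph on $n$ vertices. Then $$\mathcal{E}_{RD}(CS(n,k-1))\le \mathcal{E}_{RD}(G)\le \mathcal{E}_{RD}(T(n,k)).$$ Moreover, the left equality holds if and only if $G\cong CS(n,k-1)$, and the right equality holds if and only if $G\cong T(n,k)$.
   Context: For a connected graph $G$ with vertices $v_1,\dots,v_n$, $RD(G)$ is the $n\times n$ matrix with $(i,j)$ entry $1/d(v_i,v_j)$ for $i\ne j$ and $0$ on the diagonal ($d$ the shortest-path distance), and $\mathcal{E}_{RD}(G)=\sum_{i=1}^n|\lambda_i(RD(G))|$. The complete split graph $CS(n,k-1)$ is the complete $k$-partite graph $K_{n-k+1,1,1,\dots,1}$ (one part of size $n-k+1$ and $k-1$ parts of size $1$), i.e. a copy of $K_{k-1}$ with each of its vertices joined to $n-k+1$ independent vertices. The Turán graph $T(n,k)$ is the complete $k$-partite graph on $n$ vertices whose part sizes differ pairwise by at most one: writing $n=kq+r$ with $0\le r<k$, it has $r$ parts of size $q+1$ and $k-r$ parts of size $q$. *)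

(* Defs.v *)
From HB Require Import structures.
From mathcomp Require Import all_boot all_order all_algebra.

Set Implicit Arguments.
Unset Strict Implicit.
Unset Printing Implicit Defensive.

Import Order.TTheory GRing.Theory Num.Theory.
Local Open Scope ring_scope.

Record sgraph := SGraph {
  vertex :> finType;
  adj : rel vertex;
  adj_sym : symmetric adj;
  adj_irrefl : irreflexive adj
}.

Definition graph_iso (G H : sgraph) : Prop :=
  exists2 f : G -> H, bijective f & forall x y, adj (f x) (f y) = adj x y.

Definition has_walk (G : sgraph) (x y : G) (l : nat) : bool :=
  [exists p : l.-tuple G, path (@adj G) x p && (last x p == y)].

(* A shortest walk has length < #|G|; the value is meaningless (#|G|) when *)
(* x and y lie in different components.                                    *)
Definition dist (G : sgraph) (x y : G) : nat :=
  find (has_walk x y) (iota 0 #|G|).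

(* Entries between different components are 0, i.e. 1/oo; this never occurs *)
(* in a connected graph.                                                    *)
Definition RD (C : numClosedFieldType) (G : sgraph) : 'M[C]_#|G| :=
  \matrix_(i, j)
    let x := enum_val i in let y := enum_val j in
    if (x != y) && connect (@adj G) x y then (dist x y)%:R^-1 else 0.

(* The roots of the characteristic polynomial, listed with multiplicity. *)
Definition eigenvalues (C : numClosedFieldType) (n : nat) (A : 'M[C]_n) :
    seq C :=
  sval (closed_field_poly_normal (char_poly A)).

Lemma char_poly_eigenvalues (C : numClosedFieldType) (n : nat) (A : 'M[C]_n) :
  char_poly A = \prod_(z <- eigenvalues A) ('X - z%:P).
Proof.
rewrite /eigenvalues; case: closed_field_poly_normal => s /= {1}->.
by rewrite (monicP (char_poly_monic A)) scale1r.
Qed.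

(* RD C G is a real symmetric matrix over C, so its eigenvalues and the     *)
(* energy are real elements of C, compared by the order of C.               *)
Definition RD_energy (C : numClosedFieldType) (G : sgraph) : C :=
  \sum_(z <- eigenvalues (RD C G)) `|z|.

(* The blocks of a partition are nonempty, so there are exactly k parts. *)
Definition complete_kpartite (k : nat) (G : sgraph) : Prop :=
  exists P : {set {set G}},
    [/\ partition P [set: G], #|P| = k
      & forall x y : G, adj x y = (pblock P x != pblock P y)].

Section PartSizes.
Variables (k : nat) (m : 'I_k -> nat).

Definition parts_vertex : finType := {i : 'I_k & 'I_(m i)}.

Definition parts_adj : rel parts_vertex := fun u v => tag u != tag v.

Lemma parts_adj_sym : symmetric parts_adj.
Proof. by move=> u v; rewrite /parts_adj eq_sym. Qed.

Lemma parts_adj_irrefl : irreflexive parts_adj.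
Proof. by move=> u; rewrite /parts_adj eqxx. Qed.

(* K_{m_0, ..., m_(k-1)} *)
Definition multipartite : sgraph := SGraph parts_adj_sym parts_adj_irrefl.

End PartSizes.

(* CS n s = K_{n-s, 1, ..., 1} with s parts of size 1; meaningful for s <= n. *)
Definition CS (n s : nat) : sgraph :=
  multipartite (fun i : 'I_s.+1 => if i == ord0 then (n - s)%N else 1%N).

Definition turan (n k : nat) : sgraph :=
  multipartite
    (fun i : 'I_k => if (i < n %% k)%N then (n %/ k).+1 else (n %/ k)%N).

(* Main.v *)
Require Import Defs.
From HB Require Import structures.
From mathcomp Require Import all_boot all_order all_algebra all_fingroup.
From mathcomp Require Import sesquilinear spectral ring.

Set Implicit Arguments.
Unset Strict Implicit.
Unset Printing Implicit Defensive.

Import Order.TTheory GRing.Theory Num.Theory.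
Local Open Scope ring_scope.
Local Open Scope sesquilinear_scope.

(* For k >= 2, RD(G) = J - (I + B B^T) / 2 with B the incidence matrix of     *)
(* vertices and parts. The form is negative on the hyperplane orthogonal to   *)
(* the all-ones vector, so a single eigenvalue lam is >= 0, and trace 0 gives *)
(* the energy E = 2 lam. The eigenvector equation becomes                     *)
(*   sum_l m_l / (E + 1 + m_l) = 1 / 2,  m_l the part sizes.                  *)
(* The left side decreases in E, and t / (a + t) is strictly concave: by the  *)
(* secant through q and q + 1 (resp. through 1 and n - k + 1) the sum is      *)
(* largest (resp. smallest) exactly for the sizes of the Turan graph (resp.   *)
(* of the complete split graph), and E follows.                               *)

(** The energy thus solves a scalar equation that depends only on the part sizes
    ([RD_energy_coloring]), and comparing energies amounts to comparing sums of t / (a + t), at a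
    common a = E + 1, over families of sizes with the same total. The reference graphs have parts of
    only two sizes p and r. The secant through p and r contributes equally to both families, since
    it sees only the total; what remains is [defect], whose sign is known when all sizes lie between
    p and r or all lie outside ([share_root_inside], [share_root_outside]). It vanishes with such a
    sign only if every size is p or r; the total then determines the multiset of sizes
    ([two_valued_perm]), and [coloring_iso] gives the isomorphism.

    For k = 1 there are no edges and all three energies are 0; this case is settled separately. *)

Lemma char_poly_conj (R : comUnitRingType) (n : nat) (P A : 'M[R]_n) :
  P \in unitmx -> char_poly (invmx P *m A *m P) = char_poly A.
Proof.
move=> uP; rewrite /char_poly.
pose Q := map_mx polyC P; pose Q' := map_mx polyC (invmx P).
have QQ : Q' *m Q = 1%:M by rewrite -map_mxM mulVmx // map_mx1.
have -> : char_poly_mx (invmx P *m A *m P) = Q' *m char_poly_mx A *m Q.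
  rewrite /char_poly_mx mulmxBr mulmxBl !map_mxM; congr (_ - _).
  by rewrite scalar_mxC -mulmxA QQ mulmx1.
by rewrite !det_mulmx mulrAC -det_mulmx QQ det1 mul1r.
Qed.

(** The order of the chosen list [eigenvalues] is unspecified, so only a permutation can be claimed;
    it comes from unique factorization of the characteristic polynomial. *)
Lemma perm_eigenvalues_conj_diag (C : numClosedFieldType) (n : nat)
    (P : 'M[C]_n) (d : 'rV[C]_n) :
  P \in unitmx ->
  perm_eq (eigenvalues (invmx P *m diag_mx d *m P)) [seq d 0 i | i : 'I_n].
Proof.
move=> uP; apply: prod_XsubC_eq.
rewrite -char_poly_eigenvalues char_poly_conj // char_poly_trig ?diag_mx_is_trig //.
by rewrite big_image; apply: eq_bigr => i _; rewrite mxE eqxx mulr1n.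
Qed.

Lemma spectral_form (C : numClosedFieldType) (n : nat) (P : 'M[C]_n)
    (d u : 'rV[C]_n) :
  P \is unitarymx ->
  ((u *m P) *m (invmx P *m diag_mx d *m P) *m (u *m P)^t*) 0 0 =
  \sum_i d 0 i * `|u 0 i| ^+ 2.
Proof.
move=> uP; rewrite trmx_mul map_mxM !mulmxA mulmxK ?unitarymx_unit //.
rewrite mulmxtVK // mul_mx_diag mxE; apply: eq_bigr => i _.
by rewrite !mxE normCK; ring.
Qed.

(* Two eigenvalues of sign >= 0 would span a plane meeting the hyperplane *)
(* orthogonal to w, on which the Hermitian form of A is negative.          *)
Lemma abs_eigenvalue_sum (C : numClosedFieldType) (n : nat) (A : 'M[C]_n)
    (w : 'cV[C]_n) :
  (0 < n)%N -> A \is hermsymmx -> \tr A = 0 ->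
  (forall v : 'rV_n, v != 0 -> v *m w = 0 -> (v *m A *m v^t*) 0 0 < 0) ->
  exists lam, [/\ 0 <= lam, eigenvalue A lam
                & \sum_(z <- eigenvalues A) `|z| = lam *+ 2].
Proof.
move=> n_gt0 hA trA negA.
have /orthomx_spectralP := hermitian_normalmx hA.
have /mxOverP dR := hermitian_spectral_diag_real hA.
have := spectral_unitarymx A.
move: (spectralmx A) (spectral_diag A) dR => P d dR PU defA.
have Pu := unitarymx_unit PU.
have negd (u : 'rV_n) : u != 0 -> u *m (P *m w) = 0 ->
    \sum_i d 0 i * `|u 0 i| ^+ 2 < 0.
  move=> u0 uw; rewrite -(spectral_form d u PU) -defA; apply: negA.
    apply: contra u0 => /eqP /(congr1 (mulmx^~ (invmx P))).
    by rewrite mulmxK // mul0mx => ->.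
  by rewrite -mulmxA.
move: (P *m w) negd => y negd.
have formE i j (a b : C) : i != j ->
    \sum_l d 0 l * `|(a *: delta_mx 0 i - b *: delta_mx 0 j : 'rV_n) 0 l| ^+ 2
    = d 0 i * `|a| ^+ 2 + d 0 j * `|b| ^+ 2.
  move=> ij; rewrite (bigD1 i) //= (bigD1 j) 1?eq_sym //= big1 ?addr0.
    rewrite !mxE !eqxx /= (negPf ij) eq_sym (negPf ij) /=.
    by rewrite !mulr1 !mulr0 subr0 sub0r normrN.
  move=> l /andP[li lj]; rewrite !mxE !eqxx (negPf li) (negPf lj) /=.
  by rewrite !mulr0 subr0 normr0 expr0n mulr0.
have trd : \sum_i d 0 i = 0.
  by rewrite -mxtrace_diag -trA defA -mulmxA mxtrace_mulC mulmxK.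
have uniq_ge0 i j : i != j -> 0 <= d 0 i -> 0 <= d 0 j -> False.
  move=> ij di dj.
  have ny (a b : C) : 0 <= d 0 i * `|a| ^+ 2 + d 0 j * `|b| ^+ 2.
    by rewrite addr_ge0 // mulr_ge0 // exprn_ge0.
  have mulE (a b : C) : (a *: delta_mx 0 i - b *: delta_mx 0 j : 'rV_n) *m y
      = (a * y i 0 - b * y j 0)%:M.
    rewrite mulmxBl -!scalemxAl -!rowE.
    by apply/matrixP => s t; rewrite !ord1 !mxE mulr1n.
  (* A nonzero vector of the plane orthogonal to [y]: e_i if y_i = 0, otherwise y_j e_i - y_i e_j,
     whose j-th coordinate is nonzero. *)
  have [yi0|yi0] := eqVneq (y i 0) 0.
    have := negd (1 *: delta_mx 0 i - 0 *: delta_mx 0 j).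
    rewrite formE // mulE yi0 mulr0 mul0r subr0 => neg.
    have: d 0 i * `|1 : C| ^+ 2 + d 0 j * `|0 : C| ^+ 2 < 0.
      apply: neg; last by rewrite -scalemx1 scale0r.
      apply/eqP => /rowP/(_ i); rewrite !mxE !eqxx /= mulr1 mul0r subr0.
      by move/eqP; rewrite oner_eq0.
    by move/(le_lt_trans (ny 1 0)); rewrite ltxx.
  have := negd (y j 0 *: delta_mx 0 i - y i 0 *: delta_mx 0 j).
  rewrite formE // mulE mulrC subrr => neg.
  have: d 0 i * `|y j 0| ^+ 2 + d 0 j * `|y i 0| ^+ 2 < 0.
    apply: neg; last by rewrite -scalemx1 scale0r.
    apply/eqP => /rowP/(_ j); rewrite !mxE !eqxx /= eq_sym (negPf ij) /=.
    by rewrite mulr0 mulr1 sub0r => /eqP; rewrite oppr_eq0 (negPf yi0).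
  by move/(le_lt_trans (ny _ _)); rewrite ltxx.
have dlt0 i : ~~ (0 <= d 0 i) -> d 0 i < 0.
  by move=> h; rewrite real_ltNge ?dR ?real0.
have [i0 di0] : exists i, 0 <= d 0 i.
  apply/existsP; apply: contraT; rewrite negb_exists => /forallP neg.
  suff: \sum_i d 0 i < 0 by rewrite trd ltxx.
  rewrite -oppr_gt0 -sumrN (bigD1 (Ordinal n_gt0)) //= ltr_wpDr //.
    by apply: sumr_ge0 => i _; rewrite oppr_ge0 ltW // dlt0.
  by rewrite oppr_gt0 dlt0.
have pe : perm_eq (eigenvalues A) [seq d 0 i | i : 'I_n].
  by rewrite defA; exact: perm_eigenvalues_conj_diag.
exists (d 0 i0); split=> //.
  rewrite eigenvalue_root_char char_poly_eigenvalues root_prod_XsubC.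
  by rewrite (perm_mem pe) image_f.
rewrite (perm_big _ pe) big_image /= (bigD1 i0) //= ger0_norm //.
rewrite mulr2n; congr (_ + _).
move: trd; rewrite (bigD1 i0) //= => /eqP; rewrite addr_eq0 => /eqP ->.
rewrite -sumrN; apply: eq_bigr => j ji; rewrite ltr0_norm // dlt0 //.
by apply/negP => dj; apply: (uniq_ge0 _ _ ji).
Qed.

(** * Colour classes, their sizes and colour-preserving bijections *)

Definition class_size (T : finType) (k : nat) (c : T -> 'I_k) (l : 'I_k) : nat :=
  #|[pred x | c x == l]|.

Lemma sum_class_size (T : finType) (k : nat) (c : T -> 'I_k) :
  (\sum_l class_size c l = #|T|)%N.
Proof.
rewrite -sum1_card (partition_big c predT) //=.
by apply: eq_bigr => l _; rewrite sum1_card.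
Qed.

Lemma class_size_comp_bij (T U : finType) (k : nat) (c : U -> 'I_k)
    (f : T -> U) (l : 'I_k) :
  bijective f -> class_size (c \o f) l = class_size c l.
Proof.
move=> bij_f; rewrite /class_size -!sum1_card.
by rewrite [RHS](reindex f) //; exact: onW_bij.
Qed.

Lemma class_size_tag (k : nat) (m : 'I_k -> nat) (l : 'I_k) :
  class_size (fun u : multipartite m => tag u) l = m l.
Proof.
rewrite /class_size -[RHS]card_ord.
pose g := Tagged (fun i => 'I_(m i)) : 'I_(m l) -> {i : 'I_k & 'I_(m i)}.
have g_inj : injective g by move=> x y /eqP; rewrite eq_Tagged => /eqP.
rewrite -(card_image g_inj); apply: eq_card => -[i x]; rewrite !inE /=.
apply/eqP/imageP => [il|[y _ /(congr1 tag)]] //; subst i; by exists x.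
Qed.

Lemma class_bijection (T U : finType) (k : nat) (c : T -> 'I_k)
    (d : U -> 'I_k) :
  class_size c =1 class_size d ->
  exists2 f : T -> U, bijective f & forall x, d (f x) = c x.
Proof.
move=> cd.
have Px x : x \in [pred y | c y == c x] by rewrite inE.
(* An element goes to the element of the same rank in the class of [d] with the same colour. *)
pose f x : U := enum_val (cast_ord (cd (c x)) (enum_rank_in (Px x) x)).
have df x : d (f x) = c x.
  have := enum_valP (cast_ord (cd (c x)) (enum_rank_in (Px x) x)).
  by rewrite inE => /eqP.
exists f => //; apply: inj_card_bij; last first.
  by rewrite -(sum_class_size c) -(sum_class_size d) (eq_bigr _ (fun l _ => cd l)).
move=> x y fxy; have cxy : c x = c y by rewrite -df fxy df.
(* The type of a rank depends on the colour, so the proofs are generalized before [c y] becomes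
   [c x]. *)
move: (fxy); rewrite /f; move: (Px x) (Px y) (cd (c x)) (cd (c y)).
rewrite -cxy => px py e1 e2 /enum_val_inj /(congr1 val) /= /ord_inj.
by apply: enum_rank_in_inj.
Qed.

(** With t entries equal to r the sum is k p + (r - p) t, so for p < r the sum determines t and with
    it the multiset; for p = r both families are constant. *)
Lemma two_valued_perm (k : nat) (m m' : 'I_k -> nat) (p r : nat) :
  (p <= r)%N ->
  (forall i, (m i == p) || (m i == r)) ->
  (forall i, (m' i == p) || (m' i == r)) ->
  (\sum_i m i = \sum_i m' i)%N ->
  exists s : {perm 'I_k}, forall i, m' i = m (s i).
Proof.
move=> le_pr mpr mpr' eq_sum.
have sumE (u : 'I_k -> nat) : (forall i, (u i == p) || (u i == r)) ->
    (\sum_i u i = k * p + (r - p) * \sum_i (u i == r))%N.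
  move=> upr; rewrite big_distrr /= -[X in (X * p)%N]card_ord -sum_nat_const.
  rewrite -big_split; apply: eq_bigr => i _ /=.
  case/orP: (upr i) => /eqP ->; rewrite ?eqxx ?muln1 ?subnKC //.
  by case: eqP => [->|_]; rewrite ?subnn ?muln0 addn0.
have eq_r : (\sum_i (m i == r) = \sum_i (m' i == r))%N.
  have [pr|ne_pr] := eqVneq p r.
    by apply: eq_bigr => i _; move: (mpr i) (mpr' i); rewrite pr !orbb => -> ->.
  have lt_pr : (0 < r - p)%N by rewrite subn_gt0 ltn_neqAle ne_pr.
  apply/eqP; rewrite -(eqn_pmul2l lt_pr) -(eqn_add2l (k * p)).
  by rewrite -!sumE // eq_sum.
have countE (u : 'I_k -> nat) (a : pred nat) :
    (forall i, (u i == p) || (u i == r)) ->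
    (count a [tuple u i | i < k] =
     (\sum_i (u i == r)) * a r + (k - \sum_i (u i == r)) * a p)%N.
  have kE : k = (\sum_(i < k) 1)%N by rewrite sum_nat_const card_ord muln1.
  move=> upr; rewrite -sum1_count big_map big_mkcond /= [X in (X - _)%N]kE.
  rewrite -sumnB ?big_distrl /=; last by move=> i _; case: (_ == _).
  rewrite enumT -big_split; apply: eq_bigr => i _ /=.
  case/orP: (upr i) => /eqP ->; last by rewrite eqxx; do 2!case: (a _).
  by have [->|_] := eqVneq p r; do 2?case: (a _).
have /tuple_permP[s es] : perm_eq [tuple m' i | i < k] [tuple m i | i < k].
  by apply/seq.permP => a; rewrite !countE // eq_r.
exists s => i; move/val_inj: es => /(congr1 (fun t => tnth t i)).
by rewrite !tnth_mktuple.
Qed.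

(** * The matrix of reciprocal distances in terms of classes, and its energy equation *)

Lemma mulmx_trC_ge0 (C : numClosedFieldType) (n : nat) (u : 'rV[C]_n) :
  0 <= (u *m u^t*) 0 0.
Proof.
rewrite mxE; apply: sumr_ge0 => i _; rewrite !mxE -normCK.
by rewrite exprn_ge0.
Qed.

Lemma mulmx_trC_gt0 (C : numClosedFieldType) (n : nat) (u : 'rV[C]_n) :
  u != 0 -> 0 < (u *m u^t*) 0 0.
Proof.
move=> u0; rewrite lt_def mulmx_trC_ge0 andbT; apply: contra u0 => /eqP.
rewrite mxE => /eqP; rewrite psumr_eq0 => [/allP u0|i _]; last first.
  by rewrite !mxE -normCK exprn_ge0.
apply/eqP/rowP => i; have := u0 i (mem_index_enum _).
by rewrite !mxE -normCK sqrf_eq0 normr_eq0 => /eqP.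
Qed.

Section PartiteMatrix.
Variables (C : numClosedFieldType) (n k : nat) (e : 'I_n -> 'I_k).

(** The entries are 0 on the diagonal, 1/2 within a class and 1 across classes: the reciprocals of
    the distances 2 and 1. *)
Definition partite_mx : 'M[C]_n :=
  \matrix_(i, j) (1 - 2^-1 * (i == j)%:R - 2^-1 * (e i == e j)%:R).

Definition class_mx : 'M[C]_(n, k) := \matrix_(i, l) (e i == l)%:R.

Lemma partite_mxE :
  partite_mx = const_mx 1 *m (const_mx 1 : 'rV_n)
    - 2^-1 *: (1%:M + class_mx *m class_mx^t*).
Proof.
apply/matrixP => i j; rewrite !mxE big_ord1 !mxE mulr1.
rewrite (bigD1 (e i)) //= big1 ?addr0 => [|l li].
  by rewrite !mxE eqxx mul1r rmorph_nat mulrDr opprD addrA (eq_sym (e j)).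
by rewrite !mxE eq_sym (negPf li) mul0r.
Qed.

Lemma partite_mx_hermsym : partite_mx \is hermsymmx.
Proof.
apply: realsym_hermsym; last first.
  apply/mxOverP => i j; rewrite mxE.
  by rewrite !realB ?realM ?realV ?realn ?real1.
apply/is_hermitianmxP/matrixP => i j.
by rewrite expr0 scale1r !mxE eq_sym (eq_sym (e i)).
Qed.

Lemma partite_mx_trace : \tr partite_mx = 0.
Proof.
rewrite /mxtrace big1 // => i _; rewrite mxE !eqxx mulr1 -addrA -opprD.
by rewrite -mulr2n -(mulr_natr 2^-1) mulVf ?pnatr_eq0 // subrr.
Qed.

(** The all-ones matrix J drops out on this hyperplane, leaving -(|v|^2 + |v B|^2) / 2 with B =
    [class_mx]. *)
Lemma partite_mx_neg (v : 'rV[C]_n) :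
  v != 0 -> v *m const_mx 1 = 0 :> 'M_1 -> (v *m partite_mx *m v^t*) 0 0 < 0.
Proof.
move=> v0 v1; rewrite partite_mxE mulmxBr mulmxA v1 mul0mx sub0r.
rewrite -scalemxAr mulmxDr mulmx1 mulNmx -scalemxAl mulmxDl mxE oppr_lt0 mxE.
rewrite mulr_gt0 ?invr_gt0 ?ltr0n // mxE ltr_pwDl ?mulmx_trC_gt0 //.
have -> : v *m (class_mx *m class_mx^t*) *m v^t*
          = (v *m class_mx) *m (v *m class_mx)^t*.
  by rewrite trmx_mul map_mxM !mulmxA.
exact: mulmx_trC_ge0.
Qed.

(* With s l the sum of an eigenvector over the class l and S its total sum,  *)
(* the eigenvalue equation summed over l reads (2 lam + 1 + m l) s l =       *)
(* 2 S m l, and S <> 0 since otherwise s, hence the eigenvector, vanishes.   *)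
Lemma partite_mx_eigenvalue (lam : C) :
  0 <= lam -> eigenvalue partite_mx lam ->
  \sum_l (class_size e l)%:R / (lam *+ 2 + 1 + (class_size e l)%:R) = 2^-1.
Proof.
move=> lam_ge0 /eigenvalueP[v Av v_neq0].
pose S := \sum_i v 0 i; pose s l := \sum_(i | e i == l) v 0 i.
have two0 : 2 != 0 :> C by rewrite pnatr_eq0.
have Ev j : S - 2^-1 * v 0 j - 2^-1 * s (e j) = lam * v 0 j.
  move/rowP/(_ j): Av; rewrite !mxE => <-.
  have -> : 2^-1 * s (e j) = \sum_i v 0 i * (2^-1 * (e i == e j)%:R).
    rewrite /s mulr_sumr big_mkcond; apply: eq_bigr => i _ /=.
    by case: (e i == e j); rewrite ?mulr1 ?mulr0 // mulrC.
  have -> : 2^-1 * v 0 j = \sum_i v 0 i * (2^-1 * (i == j)%:R).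
    rewrite (bigD1 j) //= eqxx big1 ?addr0 => [|i ij].
      by rewrite mulr1 mulrC.
    by rewrite (negPf ij) !mulr0.
  by rewrite /S -!sumrB; apply: eq_bigr => i _; rewrite mxE !mulrBr mulr1.
have Es l : s l * (lam *+ 2 + 1 + (class_size e l)%:R)
            = S * (class_size e l)%:R * 2.
  have : \sum_(j | e j == l) (S - 2^-1 * v 0 j - 2^-1 * s l)
         = \sum_(j | e j == l) lam * v 0 j.
    by apply: eq_bigr => j /eqP <-; exact: Ev.
  rewrite !sumrB -!mulr_sumr -/(s l) !sumr_const -/(class_size e l).
  move/eqP; rewrite !subr_eq => /eqP h.
  by rewrite [S * _]mulr_natr h -[s l *+ _]mulr_natr; field.
have den0 l : lam *+ 2 + 1 + (class_size e l)%:R != 0.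
  by rewrite gt_eqF // ltr_wpDr ?ler0n // ltr_wpDl ?mulrn_wge0.
have sE l : s l =
    S * 2 * ((class_size e l)%:R / (lam *+ 2 + 1 + (class_size e l)%:R)).
  by apply: (mulIf (den0 l)); rewrite Es mulrA mulfVK // mulrAC.
have S0 : S != 0.
  apply: contra v_neq0 => /eqP S0; apply/eqP/rowP => j; rewrite mxE.
  have := Ev j; rewrite sE S0 !mul0r mulr0 subr0 sub0r => /eqP.
  rewrite -subr_eq0 -opprD oppr_eq0 -mulrDl mulf_eq0 => /orP[|/eqP //].
  by rewrite gt_eqF // ltr_wpDr ?invr_gt0 ?ltr0n.
(* Summing [sE] over the classes gives S = 2 S times the wanted sum, and S cancels. *)
have : S = \sum_l s l by rewrite /S (partition_big e predT).
rewrite (eq_bigr _ (fun l _ => sE l)) -mulr_sumr => /eqP.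
rewrite -[X in X == _]mulr1 -mulrA (inj_eq (mulfI S0)) => /eqP h.
by apply: (mulfI two0); rewrite -h mulfV.
Qed.

Lemma partite_mx_energy (E := \sum_(z <- eigenvalues partite_mx) `|z|) :
  (0 < n)%N -> 0 <= E
  /\ \sum_l (class_size e l)%:R / (E + 1 + (class_size e l)%:R) = 2^-1.
Proof.
move=> n_gt0.
have [lam [lam_ge0 eig_lam sumE]] := abs_eigenvalue_sum n_gt0
  partite_mx_hermsym partite_mx_trace partite_mx_neg.
by rewrite /E sumE mulrn_wge0 // partite_mx_eigenvalue.
Qed.

End PartiteMatrix.

(** * Concavity of t / (a + t) and comparison of the roots *)

Section PartSizeComparison.
Variables (C : numClosedFieldType) (k : nat).
Implicit Types (a b : C) (m : 'I_k -> nat) (p r : nat).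

(** The left side of the energy equation, with [a] standing for E + 1. *)
Definition share a m : C := \sum_l (m l)%:R / (a + (m l)%:R).

(** Times a / ((a + p) (a + r)), each summand is the excess of t / (a + t) over its secant through p
    and r, at t = [m l]. *)
Definition defect a p r m : C :=
  \sum_l ((m l)%:R - p%:R) * (r%:R - (m l)%:R) / (a + (m l)%:R).

(* The first two summands collect the secant of t / (a + t) through p and r. *)
Lemma share_defect a p r m : 0 < a ->
  share a m
  = (k%:R * p%:R * r%:R + a * (\sum_l m l)%N%:R + a * defect a p r m)
    / ((a + p%:R) * (a + r%:R)).
Proof.
move=> a_gt0; have nz t : a + t%:R != 0 by rewrite gt_eqF // ltr_wpDr ?ler0n.
have -> : k%:R * p%:R * r%:R = \sum_(l < k) p%:R * r%:R :> C.
  by rewrite sumr_const card_ord -(mulr_natl (p%:R * _)) mulrA.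
rewrite natr_sum !mulr_sumr -!big_split mulr_suml /=.
by apply: eq_bigr => l _; field; rewrite !nz.
Qed.

Lemma defect_two_valued a p r m :
  (forall l, (m l == p) || (m l == r)) -> defect a p r m = 0.
Proof.
move=> mpr; rewrite /defect big1 // => l _.
by case/orP: (mpr l) => /eqP ->; rewrite subrr ?mulr0 !mul0r.
Qed.

Lemma defect_inside_ge0 a p r m l :
  0 < a -> (p <= m l <= r)%N ->
  0 <= ((m l)%:R - p%:R) * (r%:R - (m l)%:R) / (a + (m l)%:R).
Proof.
move=> a_gt0 /andP[pm mr]; rewrite divr_ge0 ?mulr_ge0 ?subr_ge0 ?ler_nat //.
by rewrite addr_ge0 ?ler0n // ltW.
Qed.

Lemma defect_outside_le0 a p r m l :
  0 < a -> (p <= r)%N -> (m l <= p)%N || (r <= m l)%N ->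
  ((m l)%:R - p%:R) * (r%:R - (m l)%:R) / (a + (m l)%:R) <= 0.
Proof.
move=> a_gt0 pr out; apply: mulr_le0_ge0; last first.
  by rewrite invr_ge0 addr_ge0 ?ler0n // ltW.
case/orP: out => [mp|rm].
  by rewrite mulr_le0_ge0 ?subr_le0 ?subr_ge0 ?ler_nat // (leq_trans mp).
by rewrite mulr_ge0_le0 ?subr_le0 ?subr_ge0 ?ler_nat // (leq_trans pr).
Qed.

Lemma defect_term_eq0 a p r m l : 0 < a ->
  ((m l)%:R - p%:R) * (r%:R - (m l)%:R) / (a + (m l)%:R) = 0 ->
  (m l == p) || (m l == r).
Proof.
move=> a_gt0 /eqP; rewrite !mulf_eq0 invr_eq0 !subr_eq0 !eqr_nat.
rewrite [a + _ == 0]gt_eqF ?orbF ?ltr_wpDr ?ler0n //.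
by case/orP => [->|]; rewrite // eq_sym => ->; rewrite orbT.
Qed.

Lemma share_lt a b m (l : 'I_k) :
  0 < a -> a < b -> (0 < m l)%N -> share b m < share a m.
Proof.
move=> a_gt0 ab ml_gt0; have b_gt0 := lt_trans a_gt0 ab.
have pos c t : 0 < c -> 0 < c + t%:R :> C by move=> c0; rewrite ltr_wpDr ?ler0n.
rewrite /share (bigD1 l) //= [ltRHS](bigD1 l) //= ltr_leD //.
  by rewrite ltr_pM2l ?ltr0n // ltf_pV2 ?posrE ?pos // ltrD2r.
apply: ler_sum => i _; apply: ler_wpM2l; first exact: ler0n.
by rewrite lef_pV2 ?posrE ?pos // lerD2r ltW.
Qed.

(** As [share] decreases in its first argument, b < a would give share a m' < share b m' = share a m
    <= share a m'. *)
Lemma share_root_le a b m m' (l : 'I_k) :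
  0 < a -> 0 < b -> (0 < m' l)%N ->
  share a m = share b m' -> share a m <= share a m' -> a <= b.
Proof.
move=> a_gt0 b_gt0 m_gt0 eq_s le_s.
(* The order of [C] is partial; [a] and [b] are comparable because positive elements are real. *)
rewrite real_leNgt ?gtr0_real //; apply/negP => ba.
have := share_lt b_gt0 ba m_gt0.
by rewrite -eq_s => /(le_lt_trans le_s); rewrite ltxx.
Qed.

Lemma share_root_unique a b m (l : 'I_k) :
  0 < a -> 0 < b -> (0 < m l)%N -> share a m = share b m -> a = b.
Proof.
move=> a_gt0 b_gt0 m_gt0 eq_s; apply: le_anti.
have ab := share_root_le a_gt0 b_gt0 m_gt0 eq_s (lexx _).
by rewrite ab (share_root_le b_gt0 a_gt0 m_gt0 (esym eq_s) (lexx _)).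
Qed.

(** Equal totals make the secant parts agree, and the family with values p and r has no defect, so
    only the defect of [m] remains. *)
Lemma share_two_valued a p r m m' :
  0 < a -> (\sum_l m l = \sum_l m' l)%N ->
  (forall l, (m' l == p) || (m' l == r)) ->
  share a m = share a m' + a / ((a + p%:R) * (a + r%:R)) * defect a p r m.
Proof.
move=> a_gt0 eq_sum mpr.
have nz t : a + t%:R != 0 by rewrite gt_eqF // ltr_wpDr ?ler0n.
rewrite !(@share_defect a p r) // eq_sum (defect_two_valued _ mpr).
by field; rewrite !nz.
Qed.

(** All defect terms are <= 0, so at [a] the family [m] has the smaller share, hence the smaller
    root; equal roots force every term to vanish. *)
Lemma share_root_outside a b p r m m' (l : 'I_k) :
  0 < a -> 0 < b -> (0 < m' l)%N -> (p <= r)%N ->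
  (\sum_l m l = \sum_l m' l)%N ->
  (forall i, (m' i == p) || (m' i == r)) ->
  (forall i, (m i <= p)%N || (r <= m i)%N) ->
  share a m = share b m' ->
  a <= b /\ (a = b -> forall i, (m i == p) || (m i == r)).
Proof.
move=> a_gt0 b_gt0 m_gt0 pr eq_sum mpr out eq_s.
have sE := share_two_valued a_gt0 eq_sum mpr.
have c_gt0 : 0 < a / ((a + p%:R) * (a + r%:R)).
  by rewrite divr_gt0 // mulr_gt0 // ltr_wpDr ?ler0n.
have t_le0 i := defect_outside_le0 a_gt0 pr (out i).
split.
  apply: (share_root_le a_gt0 b_gt0 m_gt0 eq_s); rewrite sE gerDl.
  by rewrite pmulr_rle0 //; apply: sumr_le0 => i _; exact: t_le0.
move=> eq_ab i; apply: (defect_term_eq0 a_gt0).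
move: sE; rewrite eq_s -eq_ab => /eqP; rewrite -subr_eq0 opprD addrA subrr.
rewrite sub0r oppr_eq0 mulf_eq0 (gt_eqF c_gt0) /= => d0.
apply/eqP; have := d0; rewrite /defect -oppr_eq0 -sumrN psumr_eq0.
  by move/allP/(_ i (mem_index_enum _)); rewrite oppr_eq0.
by move=> j _; rewrite oppr_ge0; exact: t_le0.
Qed.

(** Here the defect terms are >= 0, and the shares are compared at [b], with the two families
    exchanged in [share_root_le]. *)
Lemma share_root_inside a b p r m m' (l : 'I_k) :
  0 < a -> 0 < b -> (0 < m l)%N ->
  (\sum_l m l = \sum_l m' l)%N ->
  (forall i, (m' i == p) || (m' i == r)) ->
  (forall i, (p <= m i <= r)%N) ->
  share a m = share b m' ->
  b <= a /\ (a = b -> forall i, (m i == p) || (m i == r)).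
Proof.
move=> a_gt0 b_gt0 m_gt0 eq_sum mpr ins eq_s.
have c_gt0 (c : C) : 0 < c -> 0 < c / ((c + p%:R) * (c + r%:R)).
  by move=> c_gt0; rewrite divr_gt0 // mulr_gt0 // ltr_wpDr ?ler0n.
have t_ge0 (c : C) i (c_gt0 : 0 < c) := defect_inside_ge0 c_gt0 (ins i).
split.
  apply: (share_root_le b_gt0 a_gt0 m_gt0 (esym eq_s)).
  rewrite (share_two_valued b_gt0 eq_sum mpr) lerDl.
  apply: mulr_ge0; first exact: ltW (c_gt0 _ b_gt0).
  by apply: sumr_ge0 => i _; exact: t_ge0.
move=> eq_ab i; apply: (defect_term_eq0 a_gt0).
have := share_two_valued a_gt0 eq_sum mpr.
rewrite eq_s -eq_ab => /eqP; rewrite -subr_eq0 opprD addrA subrr.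
rewrite sub0r oppr_eq0 mulf_eq0 (gt_eqF (c_gt0 _ a_gt0)) /= => d0.
apply/eqP; have := d0; rewrite /defect psumr_eq0.
  by move/allP/(_ i (mem_index_enum _)).
by move=> j _; exact: t_ge0.
Qed.

End PartSizeComparison.

(** * Complete multipartite graphs as colourings, and their isomorphisms *)

(** A colour map indexes the parts by ['I_k], as in [multipartite]; that no part is empty is stated
    apart, by positive class sizes. *)
Definition complete_coloring (G : sgraph) (k : nat) (c : G -> 'I_k) : Prop :=
  forall x y, adj x y = (c x != c y).

Lemma complete_coloring_tag (k : nat) (m : 'I_k -> nat) :
  complete_coloring (fun u : multipartite m => tag u).
Proof. by []. Qed.

Lemma complete_kpartite_coloring (k : nat) (G : sgraph) :
  (0 < k)%N -> complete_kpartite k G ->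
  exists2 c : G -> 'I_k, complete_coloring c & forall l, (0 < class_size c l)%N.
Proof.
move=> k_gt0 [P [partP cardP adjP]]; subst k.
have /card_gt0P[B0 PB0] := k_gt0.
have [/eqP covP trivP P0] := and3P partP.
have inP (x : G) : pblock P x \in P by rewrite pblock_mem // covP inE.
exists (fun x => enum_rank_in PB0 (pblock P x)) => [x y|l].
  rewrite adjP; congr (~~ _); apply/eqP/eqP => [-> //|].
  by apply: enum_rank_in_inj.
have Pl : enum_val l \in P := enum_valP l.
have /set0Pn[x xl] : enum_val l != set0 by apply: contra P0 => /eqP <-.
by apply/card_gt0P; exists x; rewrite inE (def_pblock trivP Pl xl) enum_valK_in.
Qed.

Lemma coloring_iso (G H : sgraph) (k : nat) (c : G -> 'I_k) (d : H -> 'I_k)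
    (s : {perm 'I_k}) :
  complete_coloring c -> complete_coloring d ->
  (forall l, class_size d l = class_size c (s l)) -> graph_iso G H.
Proof.
move=> cP dP sizeE.
have [f bij_f fP] : exists2 f : G -> H, bijective f & forall x, s (d (f x)) = c x.
  have [|f bij_f fP] := @class_bijection G H k c (s \o d); last by exists f.
  move=> l; rewrite -[l](permKV s) -sizeE; apply: eq_card => x.
  by rewrite !inE /= (inj_eq perm_inj).
by exists f => // x y; rewrite cP dP -!fP (inj_eq perm_inj).
Qed.

Lemma two_valued_iso (G H : sgraph) (k : nat) (c : G -> 'I_k) (d : H -> 'I_k)
    (p r : nat) :
  complete_coloring c -> complete_coloring d -> (p <= r)%N -> #|G| = #|H| ->
  (forall l, (class_size c l == p) || (class_size c l == r)) ->
  (forall l, (class_size d l == p) || (class_size d l == r)) -> graph_iso G H.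
Proof.
move=> cP dP pr GH cpr dpr.
have [|s sP] := two_valued_perm pr cpr dpr; first by rewrite !sum_class_size.
exact: (coloring_iso cP dP sP).
Qed.

(** * Distances and energy of a complete multipartite graph *)

Lemma has_walk0 (G : sgraph) (x y : G) : has_walk x y 0 = (x == y).
Proof.
apply/existsP/idP => [[p]|xy]; first by rewrite tuple0.
by exists [tuple].
Qed.

Lemma has_walk1 (G : sgraph) (x y : G) : has_walk x y 1 = adj x y.
Proof.
apply/existsP/idP => [[p]|xy]; last by exists [tuple y]; rewrite /= xy eqxx.
by case/tupleP: p => z p; rewrite tuple0 /= andbT => /andP[xz /eqP <-].
Qed.

Lemma has_walk2 (G : sgraph) (x z y : G) :
  adj x z -> adj z y -> has_walk x y 2.
Proof.
by move=> xz zy; apply/existsP; exists [tuple z; y]; rewrite /= xz zy eqxx.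
Qed.

Lemma dist_coloring (G : sgraph) (k : nat) (c : G -> 'I_k) (x y z : G) :
  complete_coloring c -> c z != c x -> x != y ->
  dist x y = (if c x == c y then 2 else 1)%N.
Proof.
move=> cP zx xy.
(* [dist] tries only lengths below [#|G|]: length 1 needs two vertices, and length 2, further down,
   needs the third vertex [z]. *)
have card2 : (2 <= #|G|)%N.
  have: uniq [:: x; y] by rewrite /= inE xy.
  by move/card_uniqP => /= <-; exact: max_card.
rewrite /dist; case cxy: (c x == c y); last first.
  move: card2; case: #|G| => [|[|n]] // _.
  by rewrite /= has_walk0 (negPf xy) has_walk1 cP cxy.
have card3 : (3 <= #|G|)%N.
  have: uniq [:: x; y; z].
    rewrite /= !inE negb_or xy andbT /=; apply/andP; split.
      by apply: contraNneq zx => ->.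
    by apply: contraNneq zx => <-; rewrite eq_sym.
  by move/card_uniqP => /= <-; exact: max_card.
move: card3; case: #|G| => [|[|[|n]]] // _.
rewrite /= has_walk0 (negPf xy) has_walk1 cP cxy /=.
by rewrite (@has_walk2 G x z y) // cP -?(eqP cxy) // eq_sym.
Qed.

(** A vertex of another colour is a common neighbour of any two vertices of one class, so all pairs
    are connected and distances are 1 or 2. *)
Lemma RD_coloring (C : numClosedFieldType) (G : sgraph) (k : nat)
    (c : G -> 'I_k) :
  complete_coloring c -> (forall x, exists z, c z != c x) ->
  RD C G = partite_mx C (c \o enum_val).
Proof.
move=> cP cne; apply/matrixP => i j; rewrite !mxE /=.
rewrite (inj_eq enum_val_inj).
have half : 1 - 2^-1 - 2^-1 = 0 :> C by field.
have [->|ij] := eqVneq i j; first by rewrite eqxx !mulr1 half.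
have [z zi] := cne (enum_val i).
have xy : enum_val i != enum_val j by rewrite (inj_eq enum_val_inj).
have -> : connect (@adj G) (enum_val i) (enum_val j).
  have [cij|cij] := boolP (c (enum_val i) == c (enum_val j)).
    apply: (@connect_trans _ _ z); apply: connect1; rewrite cP // 1?eq_sym //.
    by rewrite eq_sym -(eqP cij).
  by apply: connect1; rewrite cP.
rewrite /= (dist_coloring cP zi xy).
case: (c (enum_val i) == c (enum_val j)) => /=; last by field.
by field.
Qed.

Lemma RD_energy_coloring (C : numClosedFieldType) (G : sgraph) (k : nat)
    (c : G -> 'I_k) :
  (1 < k)%N -> complete_coloring c -> (forall l, (0 < class_size c l)%N) ->
  0 <= RD_energy C G /\ share (RD_energy C G + 1) (class_size c) = 2^-1.
Proof.
move=> k_gt1 cP c_gt0.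
have cne x : exists z, c z != c x.
  have [l lx] : exists l, l != c x.
    apply/existsP; rewrite -[[exists l, _]]negbK negb_exists; apply/negP.
    move/forallP => h; have: (#|'I_k| <= 1)%N.
      rewrite -(card1 (c x)); apply: subset_leq_card; apply/subsetP => l _.
      by rewrite inE; move: (h l); rewrite negbK.
    by rewrite card_ord leqNgt k_gt1.
  by have /card_gt0P[z] := c_gt0 l; rewrite inE => /eqP zl; exists z; rewrite zl.
have G_gt0 : (0 < #|G|)%N.
  have /card_gt0P[z _] := c_gt0 (Ordinal k_gt1).
  by apply/card_gt0P; exists z.
rewrite /RD_energy (RD_coloring C cP cne).
have [E_ge0 EE] := partite_mx_energy C (c \o enum_val) G_gt0.
split=> //; rewrite -EE /share; apply: eq_bigr => l _.
by rewrite class_size_comp_bij //; exact: enum_val_bij.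
Qed.

(** Distinct vertices are disconnected, so by the convention for such entries the matrix is zero. *)
Lemma RD_energy_edgeless (C : numClosedFieldType) (G : sgraph) :
  (forall x y : G, ~~ adj x y) -> RD_energy C G = 0.
Proof.
move=> nadj; have RD0 : RD C G = 0.
  apply/matrixP => i j; rewrite !mxE /=; case: ifP => // /andP[xy].
  case/connectP => -[|z p] /=; last by rewrite (negPf (nadj _ _)).
  by move=> _ yx; rewrite yx eqxx in xy.
rewrite /RD_energy RD0 big_seq big1 // => z.
rewrite -root_prod_XsubC -char_poly_eigenvalues -eigenvalue_root_char.
case/eigenvalueP => v; rewrite mulmx0 => /esym/eqP; rewrite scaler_eq0.
by case/orP => [/eqP ->|->]; rewrite ?normr0.
Qed.

(** The colouring pulled back along the isomorphism has the same class sizes, and the energy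
    equation has only one root. *)
Lemma RD_energy_iso (C : numClosedFieldType) (G H : sgraph) (k : nat)
    (d : H -> 'I_k) :
  (1 < k)%N -> complete_coloring d -> (forall l, (0 < class_size d l)%N) ->
  graph_iso G H -> RD_energy C G = RD_energy C H.
Proof.
move=> k_gt1 dP d_gt0 [f bij_f fP].
have sizeE l : class_size (d \o f) l = class_size d l.
  exact: class_size_comp_bij.
have [|l|EG_ge0 EG] := @RD_energy_coloring C G k (d \o f) k_gt1.
- by move=> x y; rewrite -fP dP.
- by rewrite sizeE.
have [EH_ge0 EH] := RD_energy_coloring C k_gt1 dP d_gt0.
apply: (addIr 1); apply: (share_root_unique _ _ (d_gt0 (Ordinal k_gt1))).
- by rewrite ltr_wpDl.
- by rewrite ltr_wpDl.
by rewrite EH -EG /share; apply: eq_bigr => l _; rewrite sizeE.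
Qed.

(** * The case of a single part, and vertex counts *)

Lemma monochromatic_iso (G H : sgraph) (c : G -> 'I_1) (d : H -> 'I_1) :
  complete_coloring c -> complete_coloring d -> #|G| = #|H| -> graph_iso G H.
Proof.
move=> cP dP GH; apply: (two_valued_iso cP dP (leqnn #|G|)) => // l.
  by rewrite -(sum_class_size c) big_ord1 ord1 eqxx.
by rewrite GH -(sum_class_size d) big_ord1 ord1 eqxx.
Qed.

Lemma monochromatic_energy (C : numClosedFieldType) (G : sgraph)
    (c : G -> 'I_1) :
  complete_coloring c -> RD_energy C G = 0.
Proof. by move=> cP; apply: RD_energy_edgeless => x y; rewrite cP !ord1. Qed.

Lemma card_multipartite (k : nat) (m : 'I_k -> nat) :
  #|multipartite m| = (\sum_l m l)%N.
Proof.
rewrite -(sum_class_size (fun u : multipartite m => tag u)).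
by apply: eq_bigr => l _; exact: class_size_tag.
Qed.

Lemma card_CS (n s : nat) : (s <= n)%N -> #|CS n s| = n.
Proof.
move=> le_sn; rewrite card_multipartite big_ord_recl /= sum_nat_const card_ord.
by rewrite muln1 subnK.
Qed.

Lemma card_turan (n k : nat) : (0 < k)%N -> #|turan n k| = n.
Proof.
move=> k_gt0; rewrite card_multipartite.
transitivity (\sum_(i < k) (n %/ k + (i < n %% k)))%N.
  by apply: eq_bigr => i _; case: ifP; rewrite ?addn1 ?addn0.
rewrite big_split sum_nat_const card_ord /= mulnC [RHS](divn_eq n k).
congr (_ + _)%N; rewrite -big_mkcond /= -(big_ord_widen _ (fun=> 1%N)).
  by rewrite sum_nat_const card_ord muln1.
exact/ltnW/ltn_pmod.
Qed.

(** Each of the other [k] classes takes at least one element. *)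
Lemma class_size_bounds (T : finType) (k : nat) (c : T -> 'I_k.+1)
    (l : 'I_k.+1) :
  (forall l, (0 < class_size c l)%N) -> (1 <= class_size c l <= #|T| - k)%N.
Proof.
move=> c_gt0; rewrite c_gt0 /= -(sum_class_size c) (bigD1 l) //=.
have le_k : (k <= \sum_(i | i != l) class_size c i)%N.
  have {1}-> : k = (\sum_(i < k.+1 | i != l) 1)%N.
    by rewrite sum1_card cardC1 card_ord.
  by apply: leq_sum => i _; exact: c_gt0.
by rewrite -addnBA // leq_addr.
Qed.

(** * Comparison with a reference graph whose parts have two sizes *)

Section Extremal.
Variables (C : numClosedFieldType) (G : sgraph) (k : nat) (c : G -> 'I_k).
Hypotheses (k_gt1 : (1 < k)%N) (cP : complete_coloring c).
Hypothesis c_gt0 : forall l, (0 < class_size c l)%N.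
Variables (m : 'I_k -> nat) (p r : nat).
Hypotheses (m_gt0 : forall l, (0 < m l)%N) (le_pr : (p <= r)%N).
Hypothesis mpr : forall l, (m l == p) || (m l == r).
Hypothesis card_m : #|multipartite m| = #|G|.

Let tag_gt0 l : (0 < class_size (fun u : multipartite m => tag u) l)%N.
Proof. by rewrite class_size_tag. Qed.

Let EG := RD_energy_coloring C k_gt1 cP c_gt0.
Let EH := RD_energy_coloring C k_gt1 (@complete_coloring_tag k m) tag_gt0.

Let EG1_gt0 : 0 < RD_energy C G + 1.
Proof. by rewrite ltr_wpDl // (proj1 EG). Qed.

Let EH1_gt0 : 0 < RD_energy C (multipartite m) + 1.
Proof. by rewrite ltr_wpDl // (proj1 EH). Qed.

Let eq_sum : (\sum_l class_size c l = \sum_l m l)%N.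
Proof. by rewrite sum_class_size -card_m card_multipartite. Qed.

Let eq_share : share (RD_energy C G + 1) (class_size c)
  = share (RD_energy C (multipartite m) + 1) m.
Proof.
rewrite (proj2 EG) -(proj2 EH).
by apply: eq_bigr => l _; rewrite class_size_tag.
Qed.

Let iso_two_valued :
  (forall l, (class_size c l == p) || (class_size c l == r)) ->
  graph_iso G (multipartite m).
Proof.
move=> cpr; apply: (two_valued_iso cP (@complete_coloring_tag k m) le_pr) => //.
by move=> l; rewrite class_size_tag.
Qed.

Let iso_energy :
  graph_iso G (multipartite m) -> RD_energy C G = RD_energy C (multipartite m).
Proof. exact: (RD_energy_iso C k_gt1 (@complete_coloring_tag k m) tag_gt0). Qed.

Lemma RD_energy_outside :
  (forall l, (class_size c l <= p)%N || (r <= class_size c l)%N) ->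
  RD_energy C G <= RD_energy C (multipartite m)
  /\ (RD_energy C G = RD_energy C (multipartite m)
      <-> graph_iso G (multipartite m)).
Proof.
move=> out; have [le_E eq_E] := share_root_outside EG1_gt0 EH1_gt0
  (m_gt0 (Ordinal k_gt1)) le_pr eq_sum mpr out eq_share.
split; first by move: le_E; rewrite lerD2r.
by split=> [E|]; [apply: iso_two_valued; apply: eq_E; rewrite E|].
Qed.

Lemma RD_energy_inside :
  (forall l, (p <= class_size c l <= r)%N) ->
  RD_energy C (multipartite m) <= RD_energy C G
  /\ (RD_energy C (multipartite m) = RD_energy C G
      <-> graph_iso G (multipartite m)).
Proof.
move=> ins; have [le_E eq_E] := share_root_inside EG1_gt0 EH1_gt0
  (c_gt0 (Ordinal k_gt1)) eq_sum mpr ins eq_share.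
split; first by move: le_E; rewrite lerD2r.
by split=> [E|/iso_energy //]; apply: iso_two_valued; apply: eq_E; rewrite E.
Qed.

End Extremal.

Theorem theorem6 (C : numClosedFieldType) (n k : nat) (G : sgraph)
    (k_gt0 : (0 < k)%N) (card_G : #|G| = n) (G_kpart : complete_kpartite k G) :
  [/\ RD_energy C (CS n k.-1) <= RD_energy C G,
      RD_energy C G <= RD_energy C (turan n k),
      RD_energy C (CS n k.-1) = RD_energy C G <-> graph_iso G (CS n k.-1)
    & RD_energy C G = RD_energy C (turan n k) <-> graph_iso G (turan n k)].
Proof.
have [c cP c_gt0] := complete_kpartite_coloring k_gt0 G_kpart.
(* From here [k] is one less than the number of parts, so the large part of [CS n k] has n - k
   vertices. *)
case: k k_gt0 c cP c_gt0 {G_kpart} => // k _ c cP c_gt0 /=.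
have le_kn : (k < n)%N.
  have := class_size_bounds ord0 c_gt0.
  by rewrite card_G => /andP[gt0 /(leq_trans gt0)]; rewrite subn_gt0.
have cardCS : #|CS n k| = #|G| by rewrite card_CS // ltnW.
have cardT : #|turan n k.+1| = #|G| by rewrite card_turan.
have [k0|k_gt0] := posnP k.
  (* One part: [G] is isomorphic to both reference graphs and all energies are 0, so both sides of
     each equivalence hold. *)
  subst k; have tagP := @complete_coloring_tag 1.
  have isoCS := monochromatic_iso cP (tagP _) (esym cardCS).
  have isoT := monochromatic_iso cP (tagP _) (esym cardT).
  have E0 := monochromatic_energy C cP.
  have ECS : RD_energy C (CS n 0) = 0.
    exact: (monochromatic_energy C (tagP _)).
  have ET : RD_energy C (turan n 1) = 0.
    exact: (monochromatic_energy C (tagP _)).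
  by rewrite ECS ET E0.
(* The sizes 1 and n - k are the extremes possible for k + 1 nonempty parts. *)
have [||||leCS isoCS] := @RD_energy_inside C G k.+1 c k_gt0 cP c_gt0 _
  1%N (n - k)%N _ _ _ cardCS.
- by move=> l; case: ifP; rewrite ?subn_gt0.
- by rewrite subn_gt0.
- by move=> l; case: ifP; rewrite eqxx ?orbT.
- by move=> l; rewrite -card_G; exact: class_size_bounds.
(* No integer lies strictly between the consecutive sizes q and q + 1, so every family is outside; q
   > 0 because k < n. *)
have [||||leT isoT] := @RD_energy_outside C G k.+1 c k_gt0 cP c_gt0 _
  (n %/ k.+1)%N (n %/ k.+1).+1%N _ _ _ cardT.
- by move=> l; case: ifP; rewrite ?divn_gt0.
- exact: leqnSn.
- by move=> l; case: ifP; rewrite eqxx ?orbT.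
- by move=> l; rewrite leqNgt orNb.
by split.
Qed.
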